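(* Let $T$ be a tree, let $r = \mathrm{rad}(T)$ be its radius and $n = n(T)$ its order. Then $$W(T) - \varepsilon(T) = W(L(T)) - \varepsilon(L(T)) + \frac{n(n-3)}{2} - r + 1,$$ where $L(T)$ is the line graph of $T$.
   Context: Graphs are finite and simple; $n(G)$ is the number of vertices of $G$. $d_G(u,v)$ is the number of edges on a shortest $u,v$-path. The Wiener index is $W(G)=\sum_{\{u,v\}\subseteq V(G)} d_G(u,v)$ (sum over unordered pairs of vertices). The eccentricity of a vertex $v$ is $\varepsilon_G(v)=\max_{u\in V(G)} d_G(v,u)$, and the eccentricity of the graph is $\varepsilon(G)=\sum_{v\in V(G)}\varepsilon_G(v)$. The radius $\mathrm{rad}(G)$ is the minimum of $\varepsilon_G(v)$ over $v\in V(G)$. The line graph $L(G)$ has vertex set $E(G)$, with two distinct vertices adjacent if the corresponding edges of $G$ share a common end-vertex. *)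

(* Defs.v *)
From mathcomp Require Import all_boot.

Set Implicit Arguments.
Unset Strict Implicit.
Unset Printing Implicit Defensive.

Record sgraph := SGraph {
  vertex :> finType;
  adj : rel vertex;
  adj_sym : symmetric adj;
  adj_irr : irreflexive adj }.

Section Graph.
Variable G : sgraph.
Implicit Types (u v : G) (p c : seq G) (k : nat).

(* The path has vertex sequence u :: p, hence size p edges. *)
Definition gpath u v p := [&& path (@adj G) u p, last u p == v & uniq (u :: p)].

Definition has_gpath u v k := [exists p : k.-tuple G, gpath u v p].

(* The least k such that some u,v-path has k edges; it is the junk value #|G|
   when u and v lie in different components (see distP). *)
Definition dist u v : nat := find (has_gpath u v) (iota 0 #|G|).

Definition wiener : nat :=
  (* enum_rank picks one ordered pair out of each unordered pair {u, v}. *)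
  \sum_(u : G) \sum_(v : G | enum_rank u < enum_rank v) dist u v.

Definition vecc v : nat := \max_(u : G) dist v u.

Definition ecc : nat := \sum_(v : G) vecc v.

(* vecc v <= #|G| always, so #|G| is neutral as soon as G has a vertex
   (see radiusP). *)
Definition radius : nat := \big[minn/#|G|]_(v : G) vecc v.

Definition is_connected : Prop :=
  0 < #|G| /\ forall u v, connect (@adj G) u v.

Definition is_acyclic : Prop :=
  forall c, 2 < size c -> ~ ucycle (@adj G) c.

Definition is_tree : Prop := is_connected /\ is_acyclic.

Definition edges : {set {set G}} :=
  [set A : {set G} | [exists u, exists v, adj u v && (A == [set u; v])]].

Definition edge := {A : {set G} | A \in edges}.

Definition line_adj (e f : edge) : bool :=
  (e != f) && (val e :&: val f != set0).

Lemma line_adj_sym : symmetric line_adj.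
Proof. by move=> e f; rewrite /line_adj eq_sym setIC. Qed.

Lemma line_adj_irr : irreflexive line_adj.
Proof. by move=> e; rewrite /line_adj eqxx. Qed.

Lemma gpath_size u v p : gpath u v p -> size p < #|G|.
Proof. by case/and3P=> _ _ /card_uniqP /= <-; apply: max_card. Qed.

Lemma dist_min u v p : gpath u v p -> dist u v <= size p.
Proof.
move=> up; have szp := gpath_size up; rewrite leqNgt; apply/negP=> lt_p.
have := before_find 0 lt_p; rewrite nth_iota // add0n => /existsP; apply.
by exists (in_tuple p).
Qed.

Lemma dist_le_card u v : dist u v <= #|G|.
Proof. by rewrite -[leqRHS](size_iota 0); apply: find_size. Qed.

Lemma distP u v : connect (@adj G) u v ->
  (exists2 p, gpath u v p & size p = dist u v) /\
  (forall p, gpath u v p -> dist u v <= size p).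
Proof.
case/connectP=> q /shortenP[p pp Up _] ->; split; last exact: dist_min.
have up : gpath u (last u p) p by rewrite /gpath pp eqxx Up.
have lt_d : dist u (last u p) < #|G|.
  exact: leq_ltn_trans (dist_min up) (gpath_size up).
have : has (has_gpath u (last u p)) (iota 0 #|G|) by rewrite has_find size_iota.
move/(nth_find 0); rewrite -/(dist _ _) nth_iota // add0n => /existsP[t ut].
by exists t; rewrite ?size_tuple.
Qed.

Lemma radiusP : 0 < #|G| ->
  (exists v, radius = vecc v) /\ (forall v, radius <= vecc v).
Proof.
have radius_le v : radius <= vecc v.
  move: (mem_index_enum v); rewrite /radius; elim: (index_enum G) => // w s IH.
  by rewrite inE big_cons geq_min => /predU1P[->|/IH->]; rewrite ?leqnn ?orbT.
have vecc_le v : vecc v <= #|G| by apply/bigmax_leqP => u _; apply: dist_le_card.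
case/card_gt0P=> v0 _; split=> //.
suff [radiusE|//] : radius = #|G| \/ exists v, radius = vecc v.
  by exists v0; apply/eqP; rewrite eqn_leq radius_le radiusE vecc_le.
rewrite /radius; elim/big_rec: _ => [|v m _ IH]; first by left.
by case: (leqP (vecc v) m) => _; [right; exists v | exact: IH].
Qed.

End Graph.

Definition line_graph (G : sgraph) : sgraph :=
  SGraph (@line_adj_sym G) (@line_adj_irr G).

(* Main.v *)
(* For edges e, f of a tree T, d_L(e, f) + 1 is the largest distance in T between
   an end of e and an end of f. Rooting T at c makes v |-> {v, parent of v} a
   bijection from the vertices v <> c to the edges.
   Rooting at an end of e, sum_f (d_L(e, f) + 1) + 1 = sum_x max_(u in e) d(u, x);
   summing over e, exchanging the sums, and rooting at x in the inner one gives
   2 W(T) = 2 W(L(T)) + n (n - 1).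
   Likewise the eccentricity of e = {u, v} in L(T) plus one is the larger of the
   eccentricities of u and v, which is that of the child when T is rooted at a
   centre; hence eps(T) = eps(L(T)) + (n - 1) + r. *)
Require Import Defs.
From mathcomp Require Import all_boot all_order all_algebra.
From mathcomp Require Import zify lra.
Import GRing.Theory.

Set Implicit Arguments.
Unset Strict Implicit.
Unset Printing Implicit Defensive.

(** * Distances in connected graphs *)

Section Distance.
Variable G : sgraph.
Implicit Types u v w x y : G.

Lemma dist_walk u p : path (@adj G) u p -> dist u (last u p) <= size p.
Proof.
case/shortenP=> q qp Uq sqp; apply: (@leq_trans (size q)).
  by apply: dist_min; rewrite /gpath qp eqxx Uq.
by case/andP: Uq => _ Uq; apply: uniq_leq_size.
Qed.

Lemma distxx u : dist u u = 0.
Proof. by apply/eqP; rewrite -leqn0; apply: (@dist_walk u [::]). Qed.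

(** The Lipschitz condition bounds [h] at the end of a walk from [u] by its length; descending along
    [h] yields a walk that attains the bound. Connectedness is a by-product, so this applies to the
    line graph. *)
Lemma dist_potential u (h : G -> nat) :
    h u = 0 -> (forall x y, adj x y -> h y <= (h x).+1) ->
    (forall x, x != u -> exists2 y, adj y x & h y < h x) ->
  forall x, dist u x = h x.
Proof.
move=> hu h_lip h_desc x.
have h_walk p v : path (@adj G) v p -> h (last v p) <= h v + size p.
  elim: p v => [|w p IH] v /=; first by rewrite addn0.
  by case/andP=> /h_lip vw /IH; lia.
have [p up [px szp]]: exists2 p, path (@adj G) u p & last u p = x /\ size p <= h x.
  have [k] := ubnP (h x); elim: k x => // k IH x lexk.
  have [->|/h_desc[y yx lt_yx]] := eqVneq x u; first by exists [::].
  have [|p up [py szp]] := IH y; first by lia.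
  exists (rcons p x); first by rewrite rcons_path up py.
  by rewrite last_rcons size_rcons; split=> //; lia.
have uconx : connect (@adj G) u x by apply/connectP; exists p.
have [[q /and3P[uq /eqP qx _] szq] _] := distP uconx.
have := h_walk _ _ uq; have := dist_walk up; rewrite hu px qx szq; lia.
Qed.

Hypothesis conG : forall u v, connect (@adj G) u v.

Lemma dist_gpath u v :
  exists p, [/\ path (@adj G) u p, last u p = v & size p = dist u v].
Proof. by have [[p /and3P[up /eqP pv _] szp] _] := distP (conG u v); exists p. Qed.

Lemma dist_triangle u v w : dist u w <= dist u v + dist v w.
Proof.
have [p [up pv <-]] := dist_gpath u v; have [q [vq <- <-]] := dist_gpath v w.
by rewrite -size_cat -pv -last_cat dist_walk // cat_path up pv.
Qed.

Lemma dist_eq0 u v : (dist u v == 0) = (u == v).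
Proof.
apply/eqP/eqP=> [d0|->]; last exact: distxx.
by have [[|w p] [_ /= uv]] := dist_gpath u v; rewrite d0.
Qed.

Lemma dist_adj_le1 u v : adj u v -> dist u v <= 1.
Proof. by move=> uv; apply: (@dist_walk u [:: v]); rewrite /= uv. Qed.

Lemma distC u v : dist u v = dist v u.
Proof.
suff le_d x y : dist y x <= dist x y by apply/eqP; rewrite eqn_leq !le_d.
have [p [xp <- <-]] := dist_gpath x y.
have := dist_walk (p := rev (belast x p)) (u := last x p).
rewrite rev_path size_rev size_belast.
under eq_path => ? ? do rewrite adj_sym; move/(_ xp).
by case: p xp => [|z p] _ //=; rewrite rev_cons last_rcons.
Qed.

Lemma dist_adj u v : adj u v -> dist u v = 1.
Proof.
move=> uv; apply/eqP; rewrite eqn_leq dist_adj_le1 //= lt0n dist_eq0.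
by apply: contraTneq uv => ->; rewrite adj_irr.
Qed.

Lemma dist_adj_lip x y u : adj x y -> dist u y <= (dist u x).+1.
Proof. by move=> xy; rewrite -addn1 -(dist_adj xy) dist_triangle. Qed.

Lemma dist_descent u x : x != u -> exists2 y, adj y x & dist u x = (dist u y).+1.
Proof.
have [p [up px szp]] := dist_gpath u x; case: (lastP p) up px szp.
  by move=> _ /= ->; rewrite eqxx.
move=> q z; rewrite rcons_path last_rcons size_rcons => /andP[uq qz] <- szq _.
exists (last u q) => //; apply/eqP; rewrite eqn_leq dist_adj_lip //=.
by rewrite -szq ltnS dist_walk.
Qed.

End Distance.

(** Symmetry is assumed instead of connectedness, so that the line graph is covered as well. *)
Lemma sum_sum_dist (G : sgraph) : (forall u v : G, dist u v = dist v u) ->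
  \sum_(u : G) \sum_(v : G) dist u v = (wiener G).*2.
Proof.
move=> dC; have split_sum (u : G) : \sum_(v : G) dist u v =
    \sum_(v : G | enum_rank u < enum_rank v) dist u v
    + \sum_(v : G | enum_rank v < enum_rank u) dist v u.
  rewrite (bigID (fun v : G => enum_rank u < enum_rank v)) /=; congr (_ + _).
  rewrite (bigD1 u) ?ltnn //= distxx add0n; apply: eq_big => // v.
  rewrite -leqNgt leq_eqVlt (inj_eq (@ord_inj _)) (inj_eq enum_rank_inj).
  by have [->|_] := eqVneq v u; rewrite ?ltnn ?andbT.
under eq_bigr do rewrite split_sum.
rewrite big_split /= -addnn; congr (_ + _).
by rewrite (exchange_big_dep xpredT).
Qed.

(** * Edges of a tree as bridges *)

Section Tree.
Variable T : sgraph.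
Hypothesis treeT : is_tree T.
Implicit Types (u v w x y : T) (A B : {set T}) (e f : edge T).

Lemma tree_connect u v : connect (@adj T) u v.
Proof. by case: treeT => -[_ ->]. Qed.
Let dC := distC tree_connect.
Let d_eq0 := dist_eq0 tree_connect.
Let d_adj := dist_adj tree_connect.
Let d_lip := dist_adj_lip tree_connect.
Let d_desc := dist_descent tree_connect.

Lemma adj_neq u v : adj u v -> u != v.
Proof. by apply: contraTneq => ->; rewrite adj_irr. Qed.

(** Adjacency in the tree with the edge [uv] deleted. *)
Definition avoid u v : rel T :=
  [rel x y | adj x y && ([set x; y] != [set u; v])].

Lemma avoid_sym u v : symmetric (avoid u v).
Proof. by move=> x y; rewrite /avoid /= adj_sym setUC. Qed.

Lemma avoidC u v : avoid u v =2 avoid v u.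
Proof. by move=> x y; rewrite /avoid /= (setUC [set u]). Qed.

Lemma tree_bridge u v : adj u v -> ~~ connect (avoid u v) u v.
Proof.
move=> uv; apply/negP => /connectP[q /shortenP[p up Up _]] pv.
have [_ acyc] := treeT; apply: (acyc (u :: p)).
  (* The cycle [u :: p] has at least three vertices: [p] is nonempty as [u] and [v] differ, and is
     not [[:: v]] as that edge is deleted. *)
  case: p up pv {Up} => [|w [|//]] /=.
    by move=> _ vu; rewrite vu adj_irr in uv.
  by move=> uw vw; rewrite vw /avoid /= eqxx andbF in uw.
apply/andP; split=> //=; rewrite rcons_path -pv adj_sym uv andbT.
by apply: sub_path up => x y /andP[].
Qed.

(** Walk back from [x] along a shortest path to [u]: each vertex met is still no farther from [u]
    than from [v], and a step out of a vertex other than [u] and [v] is not along [uv]. *)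
Lemma near_connect u v x :
  adj u v -> dist u x <= dist v x -> connect (avoid u v) u x.
Proof.
move=> uv; have [k] := ubnP (dist u x); elim: k x => // k IH x ltk le_uv.
have [->|xu] := eqVneq x u; first exact: connect0.
have [y yx uyE] := d_desc xu; have := d_lip v yx.
rewrite uyE in ltk le_uv => lip; have uy : connect (avoid u v) u y.
  by apply: IH; lia.
apply: connect_trans uy (connect1 _); rewrite /avoid /= yx.
have xv : x != v by rewrite eq_sym -d_eq0; lia.
apply/eqP => /setP/(_ x); rewrite !inE eqxx orbT.
by rewrite (negPf xu) (negPf xv).
Qed.

Lemma near_connect_sym u v x :
  adj u v -> dist v x <= dist u x -> connect (avoid u v) x v.
Proof.
move=> uv le_vu; rewrite (sym_connect_sym (avoid_sym u v)).
by rewrite (eq_connect (avoidC u v)) near_connect // adj_sym.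
Qed.

(** A tie would link [u] to [x] and [x] to [v] without the bridge [uv]. *)
Lemma dist_neq u v x : adj u v -> dist u x != dist v x.
Proof.
move=> uv; apply/eqP => duv; case/negP: (tree_bridge uv).
by apply: (@connect_trans _ _ x); rewrite ?near_connect ?near_connect_sym ?duv.
Qed.

Lemma crossing_edge u v x y : adj u v -> adj x y ->
  dist u x < dist v x -> dist v y < dist u y -> x = u /\ y = v.
Proof.
move=> uv xy ux vy; have: ~~ avoid u v x y.
  apply/negP => a_xy; case/negP: (tree_bridge uv).
  apply: connect_trans (near_connect uv (ltnW ux)) _.
  exact: connect_trans (connect1 a_xy) (near_connect_sym uv (ltnW vy)).
rewrite /avoid /= xy negbK => /eqP/setP E.
have := E x; have := E y; rewrite !inE !eqxx orbT /=.
move=> /esym/orP[]/eqP ? /esym/orP[]/eqP ?; subst; rewrite ?distxx // in ux vy *.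
Qed.

(* A path from [c] to [x] has to cross the edge [uv], by [crossing_edge]. *)
Lemma dist_across c u v x : adj u v -> dist c u < dist c v ->
  dist v x < dist u x -> dist c u + dist u x <= dist c x.
Proof.
move=> uv cu; have [k] := ubnP (dist c x); elim: k x => // k IH x ltk vx.
have xc : x != c by apply: contraTneq vx => ->; rewrite -leqNgt !(dC _ c) ltnW.
have [y yx cE] := d_desc xc; have lip := d_lip u yx.
have := dist_neq y uv; rewrite neq_ltn => /orP[uy|vy]; last first.
  by rewrite cE in ltk *; have := IH y ltk vy; lia.
by have [yu xv] := crossing_edge uv yx uy vx; subst; rewrite (d_adj uv); lia.
Qed.

(** * Rooting the tree at a vertex *)

(* [parent c c] is the junk value [c]. *)
Definition parent c v : T := odflt v [pick y | adj y v && (dist c y < dist c v)].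

Lemma parentP c v :
  v != c -> adj (parent c v) v /\ dist c v = (dist c (parent c v)).+1.
Proof.
move=> vc; rewrite /parent; case: pickP => [y /andP[yv lt_y]|no] /=.
  by split=> //; have := d_lip c yv; lia.
by have [y yv cE] := d_desc vc; have := no y; rewrite yv cE ltnSn.
Qed.

Lemma parent_uniq c v y : adj y v -> dist c y < dist c v -> y = parent c v.
Proof.
move=> yv cyv; have vc : v != c by rewrite eq_sym -d_eq0; lia.
have [zv cE] := parentP vc; move: (parent c v) => z in zv cE *.
apply/eqP; apply: contraTT isT => yz; have vz: adj v z by rewrite adj_sym.
have yz0 : dist y z != 0 by rewrite d_eq0.
have := dist_neq z yv; have := d_adj vz => dvz; rewrite dvz => yz1.
(* A second such neighbour [z] lies on the side of [v] across [yv], so a path from [c] to [z] would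
   pass through [y], although [z] is no farther from [c]. *)
have : dist v z < dist y z by rewrite dvz; lia.
by move/(dist_across yv cyv); have := d_lip c yv; lia.
Qed.

Lemma edges_parent c : edges T = [set [set v; parent c v] | v in [set~ c]].
Proof.
apply/setP => A; apply/idP/imsetP => [|[v]].
  rewrite inE => /existsP[u /existsP[v /andP[uv /eqP ->]]].
  have := dist_neq c uv; rewrite !(dC _ c) neq_ltn => /orP[] lt_d.
    exists v; last by rewrite -(parent_uniq uv lt_d) setUC.
    by rewrite !inE eq_sym -d_eq0; lia.
  exists u; last by rewrite -(parent_uniq _ lt_d) // adj_sym.
  by rewrite !inE eq_sym -d_eq0; lia.
rewrite !inE => /parentP[pv _] ->; apply/existsP; exists v.
by apply/existsP; exists (parent c v); rewrite adj_sym pv eqxx.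
Qed.

Lemma sum_edges c (F : {set T} -> nat) :
  \sum_(e : edge T) F (val e) = \sum_(v | v != c) F [set v; parent c v].
Proof.
rewrite -(big_sub [in edges T]) (edges_parent c) big_imset /=.
  by apply: eq_bigl => v; rewrite !inE.
(* Injectivity: distinct [v] and [w] giving the same edge would be parents of each other. *)
move=> v w; rewrite !inE => vc wc /setP E; apply/eqP; apply: contraT => vw.
have [_ dv] := parentP vc; have [_ dw] := parentP wc.
have := E v; rewrite !inE eqxx (negPf vw) => /esym/eqP vE.
have := E w; rewrite !inE eqxx eq_sym (negPf vw) => /eqP wE.
by move: dv dw; rewrite -wE -vE; lia.
Qed.

Lemma edgeP e : exists u v, adj u v /\ val e = [set u; v].
Proof.
case: e => A /= ; rewrite inE => /existsP[u /existsP[v /andP[uv /eqP ->]]].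
by exists u, v.
Qed.

(** * Largest distance from a vertex to an end of an edge *)

Definition far A x := \max_(u in A) dist u x.

Lemma far_set2 u v x : u != v -> far [set u; v] x = maxn (dist u x) (dist v x).
Proof. by move=> uv; rewrite /far big_setU1 ?inE //= big_set1. Qed.

Lemma dist_far A u x : u \in A -> dist u x <= far A x.
Proof. exact: (@leq_bigmax_cond _ _ (fun u => dist u x)). Qed.

Lemma far_lip A x y : adj x y -> far A y <= (far A x).+1.
Proof.
move=> xy; apply/bigmax_leqP => u uA.
by apply: leq_trans (d_lip u xy) _; rewrite ltnS dist_far.
Qed.

Section FixedEdge.
Variables u v : T.
Hypothesis uv : adj u v.

Lemma far_edge x : far [set u; v] x = maxn (dist u x) (dist v x).
Proof. exact: far_set2 (adj_neq uv). Qed.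

Lemma far_left : far [set u; v] u = 1.
Proof. by rewrite far_edge distxx max0n d_adj // adj_sym. Qed.

Lemma far_right : far [set u; v] v = 1.
Proof. by rewrite far_edge distxx maxn0 d_adj. Qed.

Lemma dist_lip_left x : dist u x <= (dist v x).+1.
Proof. by rewrite !(dC _ x) d_lip // adj_sym. Qed.

Lemma dist_lip_right x : dist v x <= (dist u x).+1.
Proof. by rewrite !(dC _ x) d_lip. Qed.

Lemma far_gt0 x : 0 < far [set u; v] x.
Proof. by rewrite far_edge; have := dist_neq x uv; lia. Qed.

(** The parent [p] of [x] is within [dist u p + 1 = dist u x] of both ends. Equality occurs at
    [x = v]. *)
Lemma far_parent x : x != u -> far [set u; v] (parent u x) <= far [set u; v] x.
Proof.
move=> xu; have [px dE] := parentP xu; rewrite !far_edge.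
have := dist_neq x uv; have := dist_lip_right (parent u x).
have := dist_lip_right x; lia.
Qed.

(** By [crossing_edge], [x] and [y] lie on the same side of [uv]. There [far] is one plus the
    distance to the nearer end, and adjacent vertices differ in that distance. *)
Lemma far_neq x y : adj x y -> [set x; y] != [set u; v] ->
  far [set u; v] x != far [set u; v] y.
Proof.
move=> xy nxy; have yx : adj y x by rewrite adj_sym.
have cross z t : adj z t -> [set z; t] != [set u; v] ->
    dist u z < dist v z -> dist v t < dist u t -> false.
  by move=> zt nzt uz vt; have [zu tv] := crossing_edge uv zt uz vt;
    rewrite zu tv eqxx in nzt.
have nyx : [set y; x] != [set u; v] by rewrite setUC.
have := cross x y xy nxy; have := cross y x yx nyx; rewrite !far_edge.
have := dist_neq u xy; have := dist_neq v xy; rewrite !(dC _ u) !(dC _ v).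
have := dist_neq x uv; have := dist_neq y uv; have := dist_lip_right x.
have := dist_lip_left x; have := dist_lip_right y; have := dist_lip_left y.
lia.
Qed.

(** A step towards the nearer end of [uv] decreases both distances. *)
Lemma far_desc y : y \notin [set u; v] ->
  exists2 z, adj z y & far [set u; v] z < far [set u; v] y.
Proof.
rewrite !inE negb_or => /andP[yu yv]; have := dist_neq y uv.
rewrite neq_ltn => /orP[lt_uv | lt_vu].
  have [z zy dE] := d_desc yu; exists z => //; rewrite !far_edge.
  by have := dist_lip_right z; lia.
have [z zy dE] := d_desc yv; exists z => //; rewrite !far_edge.
by have := dist_lip_left z; lia.
Qed.

End FixedEdge.

(** * Distances in the line graph *)

Definition far2 A B := \max_(x in B) far A x.

Lemma far2_set2 A x y : adj x y -> far2 A [set x; y] = maxn (far A x) (far A y).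
Proof.
by move=> /adj_neq xy; rewrite /far2 big_setU1 ?inE //= big_set1.
Qed.

Lemma edge_intro x y : adj x y -> exists e : edge T, val e = [set x; y].
Proof.
move=> xy; have xyE : [set x; y] \in edges T.
  by rewrite inE; apply/existsP; exists x; apply/existsP; exists y; rewrite xy /=.
by exists (Sub [set x; y] xyE); rewrite SubK.
Qed.

(** [dist_potential] applies to [far2 - 1]: this vanishes at [e], changes by at most one between
    edges sharing a vertex, and decreases through the end of [g] nearer to [e]. *)
Lemma line_dist (e f : line_graph T) :
  (dist e f).+1 = far2 (val e) (val f).
Proof.
have [u [v [uv Ee]]] := edgeP e; move defA: (val e) Ee => A Ee.
have bounds (g : edge T) x : x \in val g ->
    far A x <= far2 A (val g) <= (far A x).+1.
  move=> xg; rewrite /far2 (leq_bigmax_cond (F := far A) x xg) /=.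
  apply/bigmax_leqP => y yg; have [z [t [zt Eg]]] := edgeP g.
  have tz : adj t z by rewrite adj_sym.
  move: xg yg; rewrite /= in Eg *; rewrite Eg !inE.
  by move=> /orP[]/eqP-> /orP[]/eqP->; rewrite ?leqnSn ?far_lip.
have f0 x : 0 < far A x by rewrite Ee far_gt0.
suff -> : dist e f = (far2 A (val f)).-1.
  have [x [y [xy Ef]]] := edgeP f.
  by rewrite prednK // Ef far2_set2 // leq_max f0.
apply: (@dist_potential _ e (fun g : line_graph T => (far2 A (val g)).-1)).
- by rewrite defA {2}Ee far2_set2 // Ee far_left // far_right.
- move=> g h /andP[_ /set0Pn[x]]; rewrite inE => /andP[xg xh].
  by have /= := bounds g x xg; have /= := bounds h x xh; lia.
move=> g ge.
have {ge} gA : val g != A by rewrite -defA val_eqE.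
(* Orient [g] towards [e]. The next edge is [e] itself if [y] is an end of [e], and otherwise the
   edge from [y] to a neighbour with smaller [far]. *)
have [x [y [xy Eg lt_yx]]] : exists x y,
    [/\ adj x y, val g = [set x; y] & far A y < far A x].
  have [x [y [xy Eg]]] := edgeP g; have: far A x != far A y.
    by rewrite Ee far_neq // -Eg -Ee.
  rewrite neq_ltn => /orP[] lt_xy; last by exists x, y.
  by exists y, x; rewrite adj_sym setUC.
have hg : far2 A (val g) = (far A y).+1.
  by rewrite Eg far2_set2 //; have := far_lip A (y := x) (x := y);
    rewrite adj_sym => /(_ xy); lia.
have yg : y \in val g by rewrite Eg !inE eqxx orbT.
have [yA | yA] := boolP (y \in A).
  exists e.
    apply/andP; split; first by rewrite -val_eqE defA eq_sym.
    by apply/set0Pn; exists y; rewrite inE defA yA.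
  by rewrite hg defA {2}Ee far2_set2 // Ee far_left // far_right //= -Ee f0.
rewrite Ee in yA; have [z zy] := far_desc uv yA; rewrite -Ee => lt_zy.
have [h Eh] := edge_intro zy.
have hh : far2 A (val h) = far A y by rewrite Eh far2_set2 //; lia.
exists h; last by rewrite hg hh; have := f0 y; lia.
apply/andP; split.
  by apply/eqP => E; move: hh; rewrite E hg; lia.
by apply/set0Pn; exists y; rewrite inE yg Eh !inE eqxx orbT.
Qed.

Lemma line_distC (e f : line_graph T) : dist e f = dist f e.
Proof.
have farC : far2 (val e) (val f) = far2 (val f) (val e).
  rewrite /far2 /far exchange_big.
  by apply: eq_bigr => u _; apply: eq_bigr => x _; rewrite dC.
(* Rewriting with [line_dist] makes unification compare the two distances. *)
exact: succn_inj (etrans (line_dist e f) (etrans farC (esym (line_dist f e)))).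
Qed.

(** * The Wiener indices of a tree and of its line graph *)

(** Root at an end [u] of [e]. The extra one is the term of [u]; any other [x] gives the term of the
    edge to its parent, whose larger [far] is at [x]. *)
Lemma sum_line_dist (e : line_graph T) :
  (\sum_(f : line_graph T) (dist e f).+1).+1 = \sum_x far (val e) x.
Proof.
under eq_bigr do rewrite line_dist.
have [u [v [uv ->]]] := edgeP e.
rewrite (sum_edges u (far2 [set u; v])) [RHS](bigD1 u) //= far_left // add1n; congr _.+1.
apply: eq_bigr => x xu; rewrite far2_set2 1?adj_sym; last by case: (parentP xu).
exact/maxn_idPl/far_parent.
Qed.

(** For fixed [x], rooting at [x] makes the child the farther end of each edge, so the edges
    contribute the distances from [x] to all other vertices. *)
Lemma sum_far : \sum_(e : edge T) \sum_x far (val e) x = (wiener T).*2.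
Proof.
rewrite -(sum_sum_dist dC) exchange_big; apply: eq_bigr => x _.
rewrite (sum_edges x (far^~ x)) [RHS](bigD1 x) //= distxx add0n.
apply: eq_bigr => v vx; have [pv dE] := parentP vx.
by rewrite far_set2 1?eq_sym ?adj_neq // !(dC _ x) dE; apply/maxn_idPl.
Qed.

Lemma card_edge : #|{: edge T}|.+1 = #|T|.
Proof.
have [[/card_gt0P[c _] _] _] := treeT.
rewrite -sum1_card (sum_edges c (fun=> 1)) -sum1_card [RHS](bigD1 c) //=.
Qed.

Lemma wiener_line_graph :
  (wiener T).*2 = (wiener (line_graph T)).*2 + #|T| * #|T|.-1.
Proof.
rewrite -sum_far -(sum_sum_dist line_distC) -card_edge mulnC.
rewrite -sum_nat_const -big_split; apply: eq_bigr => e _ /=.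
(* Each of the [n - 1] edges [e] contributes [n] extra: one for every [f], and the one added in
   [sum_line_dist]. *)
have sumS : \sum_(f : line_graph T) (dist (e : line_graph T) f).+1
    = \sum_(f : line_graph T) dist (e : line_graph T) f + #|{: edge T}|.
  by rewrite -sum1_card -big_split; apply: eq_bigr => f _; rewrite /= addn1.
by rewrite -sum_line_dist sumS addnS.
Qed.

(** * Eccentricities of a tree and of its line graph *)

Lemma vecc_line_graph (e : line_graph T) :
  (vecc e).+1 = \max_(u in val e) vecc u.
Proof.
apply/eqP; rewrite eqn_leq; apply/andP; split.
  have dist_le (f : line_graph T) : dist e f < \max_(u in val e) vecc u.
    rewrite line_dist; apply/bigmax_leqP => x xf; apply/bigmax_leqP => u ue.
    apply: leq_trans (leq_bigmax_cond (F := @vecc T) u ue); exact: leq_bigmax.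
  have K0 := leq_ltn_trans (leq0n _) (dist_le e).
  by rewrite -(prednK K0) ltnS; apply/bigmax_leqP => f _; rewrite -ltnS prednK.
apply/bigmax_leqP => u ue; apply/bigmax_leqP => x _.
(* Line graph distances only see vertices covered by an edge; [x] is covered by [e] or by the edge
   to its parent. *)
have [f xf] : exists f : edge T, x \in val f.
  have [-> | /parentP[px _]] := eqVneq x u; first by exists e.
  by have [f Ef] := edge_intro px; exists f; rewrite Ef !inE eqxx orbT.
apply: leq_trans (dist_far x ue) _.
apply: leq_trans (leq_bigmax_cond (F := far (val e)) x xf) _.
by rewrite -/(far2 _ _) -line_dist ltnS (leq_bigmax (F := dist (e : line_graph T)) f).
Qed.

(** A vertex on the parent's side is farther from [v]. For [x] on the side of [v], a path from [c]
    passes through the parent, so its distance to [x] is at most [vecc c], the minimum. *)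
Lemma vecc_parent c v : (forall w, vecc c <= vecc w) -> v != c ->
  vecc (parent c v) <= vecc v.
Proof.
move=> c_min vc; have [pv dE] := parentP vc.
apply/bigmax_leqP => x _; have := dist_neq x pv.
rewrite neq_ltn => /orP[lt_d | gt_d].
  exact: leq_trans (ltnW lt_d) (leq_bigmax x).
apply: leq_trans (c_min v); apply: leq_trans (leq_bigmax x).
by have := dist_across pv _ gt_d (c := c); rewrite dE => /(_ (ltnSn _)); lia.
Qed.

Lemma ecc_line_graph : ecc T = ecc (line_graph T) + #|T|.-1 + radius T.
Proof.
have [[T0 _] _] := treeT; have [[c rE] r_le] := radiusP T0.
rewrite -card_edge /ecc -sum1_card -big_split /=.
(* The centre [c] accounts for the radius; the other vertices are matched with the edges to their
   parents. *)
rewrite [LHS](bigD1 c) //= -rE addnC; congr (_ + _).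
under [RHS]eq_bigr do rewrite addn1 vecc_line_graph.
rewrite (sum_edges c (fun A => \max_(u in A) vecc u)).
apply: eq_bigr => v vc; have [pv _] := parentP vc.
rewrite big_setU1 ?inE 1?eq_sym ?adj_neq //= big_set1; apply/esym/maxn_idPl.
by apply: vecc_parent => // w; rewrite -rE.
Qed.

End Tree.

(** * Combination over the rationals *)

Local Open Scope ring_scope.

Theorem theorem3p3 (T : sgraph) (hT : is_tree T) :
  let n : nat := #|T| in
  let r : nat := radius T in
  (wiener T)%:R - (ecc T)%:R
    = (wiener (line_graph T))%:R - (ecc (line_graph T))%:R
      + n%:R * (n%:R - 3%:R) / 2%:R - r%:R + 1 :> rat.
Proof.
move=> n r; have := wiener_line_graph hT; rewrite (ecc_line_graph hT) -/n -/r.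
have n0 : (0 < n)%N by case: hT => -[].
(* With [n = m + 1] no truncated predecessor remains, and the rest is
   [n(n-1)/2 - (n-1) = n(n-3)/2 + 1]. *)
rewrite -(prednK n0) succnK; move: n.-1 => m {n n0}.
rewrite -!addnn -addn1 => /(congr1 (fun k => k%:R : rat)).
rewrite !natrD !natrM !natrD; lra.
Qed.
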